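(* Let $h:\mathbb{R}^d\times\mathbb{R}^d\to\mathbb{R}$ be anti-symmetric ($h(v,v')=-h(v',v)$) and let $g:\mathbb{R}^d\times\mathbb{R}^d\to\mathbb{R}^q$ be symmetric ($g(v,v')=g(v',v)$). Suppose that $\Pr\bigl(W_i=1\mid A_i(0),A_i(1),Y_i(A_i(0)),Y_i(A_i(1)),X_i\bigr)=1/2$. Let $D_i^h=1$ if $h(V_i,V_i^N)>0$, $D_i^h=0$ if $h(V_i,V_i^N)=0$, and $D_i^h=-1$ if $h(V_i,V_i^N)<0$, and define $$\tau_{h,g}(x,\gamma)=\mathbb{E}\left[\tau_i\mid X_i=x,\ h(V_i,V_i^N)>0,\ g(V_i,V_i^N)=\gamma\right].$$ Then $$\tau_{h,g}(x,\gamma)=\mathbb{E}\left[2D_i^hY_i\mid X_i=x,\ g(V_i,V_i^N)=\gamma,\ D_i^h\neq 0\right]$$ $$=\mathbb{E}\left[Y_i\mid X_i=x,\ D_i^h=1,\ g(V_i,V_i^N)=\gamma\right]-\mathbb{E}\left[Y_i\mid X_i=x,\ D_i^h=-1,\ g(V_i,V_i^N)=\gamma\right].$$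
   Context: Setting (one generic unit $i$; all objects are random elements on a common probability space, all functions are measurable). $\mathcal{A}$ is a set of treatments; $Y_i(a)\in\mathbb{R}$ is the potential outcome of unit $i$ under treatment $a\in\mathcal{A}$. The unit has a random pair of potential treatments $A_i(0),A_i(1)\in\mathcal{A}$, characteristics $X_i$, and an assignment indicator $W_i\in\{0,1\}$. The realized and non-realized treatments are $A_i=A_i(W_i)$ and $A_i^N=A_i(1-W_i)$; the realized and non-realized outcomes are $Y_i=Y_i(A_i(W_i))$ and $Y_i^N=Y_i(A_i(1-W_i))$. A feature map $f:\mathcal{A}\to\mathbb{R}^d$ gives $V_i=f(A_i)$ and $V_i^N=f(A_i^N)$. The unit-level causal effect of the treatment received is $\tau_i=Y_i-Y_i^N$. Outcomes $Y_i(A_i(0)),Y_i(A_i(1))$ are integrable, and $\Pr(D_i^h\neq0)>0$. Convention: conditional expectations at $X_i=x$, $g(V_i,V_i^N)=\gamma$ are elementary ones when the conditioning events have positive probability, and otherwise versions of the regression functions (within the indicated event on $D_i^h$), with equality for almost every $(x,\gamma)$ with respect to the conditional law of $(X_i,g(V_i,V_i^N))$ given $D_i^h\neq 0$. *)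

(* Defs.v *)
From HB Require Import structures.
From mathcomp Require Import all_boot all_order all_algebra.
From mathcomp Require Import all_classical all_reals all_analysis.

Set Implicit Arguments.
Unset Strict Implicit.
Unset Printing Implicit Defensive.

Import Order.TTheory GRing.Theory Num.Theory.
Import numFieldNormedType.Exports.

Local Open Scope classical_set_scope.
Local Open Scope ring_scope.

(* [A false] and [A true] are the potential treatments A(0) and A(1). *)
Definition realized (T U : Type) (W : T -> bool) (A : bool -> T -> U) : T -> U :=
  fun w => A (W w) w.

Definition nonrealized (T U : Type) (W : T -> bool) (A : bool -> T -> U) : T -> U :=
  fun w => A (~~ W w) w.

(* [Y a] is the potential outcome under the fixed treatment [a]; [outcome Y B]
   is the outcome under the random treatment [B]. *)
Definition outcome (T TA U : Type) (Y : TA -> T -> U) (B : T -> TA) : T -> U :=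
  fun w => Y (B w) w.

(* E[Z | E], meant for P E > 0. *)
Definition elem_cond_exp (d : measure_display) (T : measurableType d)
    (R : realType) (P : probability T R) (E : set T) (Z : T -> R) : R :=
  (\int[P]_(w in E) Z w) / fine (P E).

(* [m] is a version of s |-> E[Z | S = s, E], the regression function of [Z] on
   [S] under P( . | E).  The normalization by P E cancels on both sides, so the
   defining identity is written with P on the trace of [E]. *)
Definition regression_version (d d' : measure_display) (T : measurableType d)
    (T' : measurableType d') (R : realType) (P : probability T R)
    (E : set T) (Z : T -> R) (S : T -> T') (m : T' -> R) : Prop :=
  [/\ measurable_fun [set: T'] m,
      P.-integrable E (EFin \o (m \o S)) &
      forall B : set T', measurable B ->
        (\int[P]_(w in E `&` S @^-1` B) (Z w)%:E =
         \int[P]_(w in E `&` S @^-1` B) (m (S w))%:E)%E].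

(* The conditional law of [S] given [E], meant for P E > 0; it is kept as a bare
   set function, which is all that {ae _, _} requires. *)
Definition cond_law (d d' : measure_display) (T : measurableType d)
    (T' : measurableType d') (R : realType) (P : probability T R)
    (E : set T) (S : T -> T') : set T' -> \bar R :=
  fun B => (((fine (P E))^-1)%:E * P (E `&` S @^-1` B))%E.

(* Main.v *)
(* Write Z = (A(0), A(1), Y(A(0)), Y(A(1)), X).  Since W is a fair coin given Z,
   flipping W does not change the law of (Z, W).  The flip exchanges Y with Y^N
   and, h being anti-symmetric, the events {D = 1} and {D = -1}; it fixes (X, G)
   because g is symmetric.  Hence, on every event C of (X, G),
     P(D = 1, C) = P(D = -1, C)  and  E[Y^N; D = 1, C] = E[Y; D = -1, C],
   so that E[tau; D = 1, C] = E[Y; D = 1, C] - E[Y; D = -1, C], which is also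
   E[2 D Y; D <> 0, C] / 2.  Dividing by P(D = 1, C) = P(D <> 0, C) / 2 gives the
   elementary version.  For the regression functions, the first identity says
   that (X, G) has the same law on {D = 1} and on {D = -1}, so all of them can be
   compared under its law on {D = 1}. *)
Require Import Defs.
From HB Require Import structures.
From mathcomp Require Import all_boot all_order all_algebra.
From mathcomp Require Import all_classical all_reals all_analysis.
From mathcomp Require Import measurable_realfun lra.

Set Implicit Arguments.
Unset Strict Implicit.
Unset Printing Implicit Defensive.

Import Order.TTheory GRing.Theory Num.Theory.
Import numFieldNormedType.Exports.

Local Open Scope classical_set_scope.
Local Open Scope ring_scope.

Lemma measurable_gt0 (d : measure_display) (T : measurableType d) (R : realType)
    (k : T -> R) :
  measurable_fun [set: T] k -> measurable [set x | 0 < k x].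
Proof.
move=> mk; rewrite (_ : [set _ | _] = k @^-1` `]0, +oo[).
  by rewrite -[_ @^-1` _]setTI; exact: mk.
by apply/seteqP; split => x /=; rewrite in_itv/= andbT.
Qed.

(** * Law of a map restricted to an event, and change of variables *)

Section restricted_law.
Context (d d' : measure_display) (T : measurableType d) (T' : measurableType d')
  (R : realType) (P : {measure set T -> \bar R}).

(** Split [B] along [E]: the part outside [E] is null for the restricted measure, and on subsets of
    the part inside [E] that measure agrees with [P]. *)
Lemma integral_mrestr (E B : set T) (mE : measurable E) (f : T -> \bar R) :
  measurable_fun [set: T] f -> measurable B ->
  (\int[mrestr P mE]_(x in B) f x = \int[P]_(x in E `&` B) f x)%E.
Proof.
move=> mf mB.
have mBE : measurable (B `&` E) by exact: measurableI.
have mBDE : measurable (B `\` E) by exact: measurableD.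
rewrite -{1}(setUIDK B E) integral_setU//; last 2 first.
- exact: measurable_funTS.
- by apply/disj_setPS => x [[_ Ex] [_ /(_ Ex)]].
rewrite (null_set_integral mBDE) ?adde0; last 2 first.
- exact: measurable_funTS.
- by rewrite /= /mrestr setDE -setIA setICl setI0 measure0.
rewrite setIC; apply: eq_measure_integral => A mA AEB.
by rewrite /= /mrestr setIidl// => x /AEB[].
Qed.

Variable S : T -> T'.
Hypothesis mS : measurable_fun [set: T] S.

(** Left unnormalized, so that laws on two events can be compared without dividing by their
    probabilities. It is closed transparently so that it unfolds to a pushforward and the lemmas on
    pushforwards apply. *)
Definition restricted_law (E : set T) (mE : measurable E) :
  {measure set T' -> \bar R}.
Proof.
by refine (pushforward (mrestr P mE) S : {measure set T' -> \bar R}); exact: mS.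
Defined.

Lemma restricted_lawE (E : set T) (mE : measurable E) (B : set T') :
  restricted_law mE B = P (E `&` S @^-1` B).
Proof. by rewrite setIC. Qed.

Lemma measurable_preim (B : set T') : measurable B -> measurable (S @^-1` B).
Proof. by move=> mB; rewrite -[_ @^-1` _]setTI; exact: mS. Qed.

Lemma ge0_integral_restricted_law (E : set T) (B : set T') (mE : measurable E)
    (f : T' -> \bar R) :
  measurable_fun [set: T'] f -> measurable B -> (forall y, (0 <= f y)%E) ->
  (\int[restricted_law mE]_(y in B) f y =
   \int[P]_(x in E `&` S @^-1` B) (f \o S) x)%E.
Proof.
move=> mf mB f0; rewrite ge0_integral_pushforward//.
- rewrite integral_mrestr//; first exact: measurableT_comp.
  exact: measurable_preim.
- exact: measurable_funTS.
Qed.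

Lemma integrable_restricted_law (E : set T) (mE : measurable E)
    (f : T' -> \bar R) :
  measurable_fun [set: T'] f -> P.-integrable E (f \o S) <->
  (restricted_law mE).-integrable [set: T'] f.
Proof.
move=> mf.
have -> : P.-integrable E (f \o S) <-> (\int[P]_(x in E) `|f (S x)| < +oo)%E.
  split=> [/integrableP[]//|intf]; apply/integrableP; split => //.
  by apply: measurable_funTS; exact: measurableT_comp.
have -> : (\int[P]_(x in E) `|f (S x)| =
    \int[restricted_law mE]_y `|f y|)%E.
  rewrite ge0_integral_restricted_law ?preimage_setT ?setIT//.
  exact: measurableT_comp.
by split=> [intf|/integrableP[]//]; apply/integrableP; split.
Qed.

Lemma integral_restricted_law (E : set T) (B : set T') (mE : measurable E)
    (f : T' -> \bar R) :
  measurable_fun [set: T'] f -> measurable B -> P.-integrable E (f \o S) ->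
  (\int[restricted_law mE]_(y in B) f y =
   \int[P]_(x in E `&` S @^-1` B) (f \o S) x)%E.
Proof.
move=> mf mB intf; rewrite integral_pushforward//.
- rewrite integral_mrestr//; first exact: measurableT_comp.
  exact: measurable_preim.
- apply: (integrableS measurableT) => //; first exact: measurable_preim.
  apply/integrableP; split; first exact: measurableT_comp.
  rewrite integral_mrestr ?setIT//; first by case/integrableP : intf.
  by do 2 apply: measurableT_comp => //.
Qed.

Section equal_laws.
Variables (E1 E2 : set T).
Hypotheses (mE1 : measurable E1) (mE2 : measurable E2).
Hypothesis eqlaw : forall B : set T', measurable B ->
  P (E1 `&` S @^-1` B) = P (E2 `&` S @^-1` B).

Lemma integrable_eq_law (f : T' -> \bar R) : measurable_fun [set: T'] f ->
  P.-integrable E1 (f \o S) -> P.-integrable E2 (f \o S).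
Proof.
move=> mf /(integrable_restricted_law mE1 mf)/integrableP[_ intf].
apply/(integrable_restricted_law mE2 mf)/integrableP; split => //.
rewrite (eq_measure_integral (restricted_law mE1))// => A mA _.
by rewrite !restricted_lawE eqlaw.
Qed.

(** Both sides are integrals of [f] over [B] against the restricted laws of [S], and these agree on
    measurable sets by [eqlaw]. *)
Lemma Rintegral_eq_law (B : set T') (f : T' -> R) :
  measurable B -> measurable_fun [set: T'] f ->
  P.-integrable E1 (EFin \o (f \o S)) ->
  \int[P]_(x in E1 `&` S @^-1` B) f (S x) =
  \int[P]_(x in E2 `&` S @^-1` B) f (S x).
Proof.
move=> mB mf intf; have mEf : measurable_fun [set: T'] (EFin \o f).
  exact/measurable_EFinP.
have intf2 := integrable_eq_law mEf intf.
rewrite /Rintegral; congr fine.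
have := integral_restricted_law mE1 mEf mB intf; rewrite /= => <-.
have := integral_restricted_law mE2 mEf mB intf2; rewrite /= => <-.
apply: eq_measure_integral => A mA _.
by rewrite !restricted_lawE eqlaw.
Qed.

End equal_laws.

(** Uniqueness of regression functions: after the change of variables, [f] and [g] have equal
    integrals over every measurable set of values of [S]. *)
Lemma ae_eq_restricted_law (E : set T) (mE : measurable E) (f g : T' -> R) :
  measurable_fun [set: T'] f -> measurable_fun [set: T'] g ->
  P.-integrable E (EFin \o (f \o S)) -> P.-integrable E (EFin \o (g \o S)) ->
  (forall B, measurable B -> \int[P]_(x in E `&` S @^-1` B) f (S x) =
                             \int[P]_(x in E `&` S @^-1` B) g (S x)) ->
  {ae restricted_law mE, forall y, f y = g y}.
Proof.
move=> mf mg intf intg fg.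
have mEf : measurable_fun [set: T'] (EFin \o f) by exact/measurable_EFinP.
have mEg : measurable_fun [set: T'] (EFin \o g) by exact/measurable_EFinP.
have : ae_eq (restricted_law mE) [set: T'] (EFin \o f) (EFin \o g).
  apply: (@integral_ae_eq _ _ _ _ _ measurableT (EFin \o g) (EFin \o f)) => //.
    exact/(integrable_restricted_law mE mEf).
  move=> B _ mB.
  have mEB : measurable (E `&` S @^-1` B).
    by apply: measurableI => //; exact: measurable_preim.
  (* The assumption compares real integrals, where [fine] sends infinite values to 0. Finiteness
     lets the equality lift back to extended reals. *)
  have fin_int (k : T' -> R) : P.-integrable E (EFin \o (k \o S)) ->
      (\int[P]_(x in E `&` S @^-1` B) (k (S x))%:E)%E \is a fin_num.
    by move=> intk; apply: integrable_fin_num => //; exact: integrableS intk.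
  rewrite (integral_restricted_law mE mEf mB intf).
  rewrite (integral_restricted_law mE mEg mB intg).
  rewrite /= -(fineK (fin_int _ intf)) -(fineK (fin_int _ intg)).
  by congr EFin; exact: fg.
by apply: filterS => y /(_ I)[].
Qed.

End restricted_law.

(** * Invariance under flipping a fair coin *)

Section fair_coin.
Context (d d' : measure_display) (T : measurableType d) (T' : measurableType d')
  (R : realType) (P : {measure set T -> \bar R}) (Z : T -> T') (W : T -> bool).
Hypotheses (mZ : measurable_fun [set: T] Z) (mW : measurable_fun [set: T] W).

Lemma measurable_coin (b : bool) : measurable (W @^-1` [set b]).
Proof. exact: measurable_preim. Qed.

(** Events that depend on the coin are families over [bool] evaluated at [W w]. The flip then acts
    by negating the index rather than by a map of the sample space. *)
Lemma coin_setE (S : bool -> set T') : [set w | S (W w) (Z w)] =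
  (W @^-1` [set true] `&` Z @^-1` S true) `|`
  (W @^-1` [set false] `&` Z @^-1` S false).
Proof.
apply/seteqP; split => w /=; last by case: (W w) => -[] [].
by case: (W w) => Sw; [left|right].
Qed.

Lemma measurable_coin_setI (b : bool) (S : set T') : measurable S ->
  measurable (W @^-1` [set b] `&` Z @^-1` S).
Proof.
by move=> mS; apply: measurableI; [exact: measurable_coin|
  exact: measurable_preim].
Qed.

Lemma measurable_coin_set (S : bool -> set T') : (forall b, measurable (S b)) ->
  measurable [set w | S (W w) (Z w)].
Proof.
by move=> mS; rewrite coin_setE; apply: measurableU; exact: measurable_coin_setI.
Qed.

Lemma disj_coin (A B : set T) :
  [disjoint W @^-1` [set true] `&` A & W @^-1` [set false] `&` B].
Proof. by apply/disj_setPS => w /= [[->] _ []]. Qed.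

Lemma measurable_coin_fun (dU : measure_display) (U : measurableType dU)
    (u : bool -> T' -> U) :
  (forall b, measurable_fun [set: T'] (u b)) ->
  measurable_fun [set: T] (fun w => u (W w) (Z w)).
Proof.
move=> mu; rewrite (_ : (fun _ => _) =
  (fun w => if W w then (u true \o Z) w else (u false \o Z) w)); last first.
  by apply/funext => w; case: (W w).
by apply: measurable_fun_ifT => //; exact: measurableT_comp.
Qed.

Lemma integrable_coin (u : bool -> T' -> R) :
  (forall b, measurable_fun [set: T'] (u b)) ->
  (forall b, P.-integrable [set: T] (EFin \o (u b \o Z))) ->
  P.-integrable [set: T] (EFin \o (fun w => u (W w) (Z w))).
Proof.
move=> mu intu.
have mu' := measurable_coin_fun mu.
(* The dominating function is the sum of the absolute values of both branches. *)
have := integrableD measurableT (integrable_abse (intu true))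
  (integrable_abse (intu false)).
apply: le_integrable => //; first exact/measurable_EFinP.
move=> w _ /=; rewrite lee_fin [leRHS]ger0_norm ?addr_ge0//.
by case: (W w); rewrite ?lerDl ?lerDr.
Qed.

Lemma Rintegral_coin (u : bool -> T' -> R) (S : bool -> set T') :
  (forall b, measurable_fun [set: T'] (u b)) ->
  (forall b, P.-integrable [set: T] (EFin \o (u b \o Z))) ->
  (forall b, measurable (S b)) ->
  \int[P]_(w in [set w | S (W w) (Z w)]) u (W w) (Z w) =
  \int[P]_(w in W @^-1` [set true] `&` Z @^-1` S true) u true (Z w) +
  \int[P]_(w in W @^-1` [set false] `&` Z @^-1` S false) u false (Z w).
Proof.
move=> mu intu mS; rewrite coin_setE Rintegral_setU.
- by congr (_ + _); apply: eq_Rintegral => w; rewrite inE => -[/= ->].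
- exact: measurable_coin_setI.
- exact: measurable_coin_setI.
- apply: (integrableS measurableT) => //; last exact: integrable_coin.
  by apply: measurableU; exact: measurable_coin_setI.
- exact: disj_coin.
Qed.

Hypothesis fair : forall B : set T', measurable B ->
  P (W @^-1` [set true] `&` Z @^-1` B) = P (W @^-1` [set false] `&` Z @^-1` B).

(** The flip exchanges the two faces of the coin in the decomposition of the event, and [fair] says
    that each piece keeps its mass on the other face. *)
Lemma measure_coin_flip (S : bool -> set T') : (forall b, measurable (S b)) ->
  P [set w | S (W w) (Z w)] = P [set w | S (~~ W w) (Z w)].
Proof.
move=> mS; rewrite coin_setE (coin_setE (fun b => S (~~ b))).
have PU (A B : set T') : measurable A -> measurable B ->
    P (W @^-1` [set true] `&` Z @^-1` A `|` W @^-1` [set false] `&` Z @^-1` B) =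
    (P (W @^-1` [set true] `&` Z @^-1` A) +
     P (W @^-1` [set false] `&` Z @^-1` B))%E.
  move=> mA mB; rewrite measureU//; [exact: measurable_coin_setI..|].
  exact/disj_set2P/disj_coin.
rewrite !PU//=.
by rewrite addeC -!fair.
Qed.

(** By [fair], [Z] has the same restricted law on both faces of the coin, so [Rintegral_eq_law]
    carries each piece of the integral to the opposite face, where it is a piece of the flipped
    integral. *)
Lemma Rintegral_coin_flip (u : bool -> T' -> R) (S : bool -> set T') :
  (forall b, measurable_fun [set: T'] (u b)) ->
  (forall b, P.-integrable [set: T] (EFin \o (u b \o Z))) ->
  (forall b, measurable (S b)) ->
  \int[P]_(w in [set w | S (W w) (Z w)]) u (W w) (Z w) =
  \int[P]_(w in [set w | S (~~ W w) (Z w)]) u (~~ W w) (Z w).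
Proof.
move=> mu intu mS; rewrite Rintegral_coin//.
rewrite (@Rintegral_coin (fun b => u (~~ b)) (fun b => S (~~ b)))//= addrC.
have intW b b' : P.-integrable (W @^-1` [set b']) (EFin \o (u b \o Z)).
  by apply: (integrableS measurableT) => //; exact: measurable_coin.
by congr (_ + _); [apply/esym|];
  apply: (Rintegral_eq_law mZ (measurable_coin _) (measurable_coin _) fair).
Qed.

End fair_coin.

(** * Identification from the sign symmetries [sign_law] and [sign_int] alone *)

Section symmetric_sign.
Context (d d' : measure_display) (T : measurableType d) (T' : measurableType d')
  (R : realType) (P : probability T R) (Y YN H : T -> R) (S : T -> T').
Hypotheses (mH : measurable_fun [set: T] H) (mS : measurable_fun [set: T] S).
Hypotheses (intY : P.-integrable [set: T] (EFin \o Y))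
  (intYN : P.-integrable [set: T] (EFin \o YN)).
Hypothesis sign_law : forall B : set T', measurable B ->
  P ([set w | 0 < H w] `&` S @^-1` B) = P ([set w | H w < 0] `&` S @^-1` B).
Hypothesis sign_int : forall B : set T', measurable B ->
  \int[P]_(w in [set w | 0 < H w] `&` S @^-1` B) YN w =
  \int[P]_(w in [set w | H w < 0] `&` S @^-1` B) Y w.

Let pos := [set w | 0 < H w].
Let neg := [set w | H w < 0].
Let nonzero := [set w | Num.sg (H w) != 0].

Let nonzeroE : nonzero = pos `|` neg.
Proof.
apply/seteqP; split => w; rewrite /nonzero/= sgr_eq0 neq_lt.
  by move=> /orP[]; [right|left].
by move=> [Hw|Hw]; apply/orP; [right|left].
Qed.

Let pos_neg_disj (A B : set T) : [disjoint pos `&` A & neg `&` B].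
Proof.
by apply/disj_setPS => w [[H0 _] [/(lt_trans H0)]]; rewrite ltxx.
Qed.

Let mpos : measurable pos.
Proof. exact: measurable_gt0. Qed.

Let mneg : measurable neg.
Proof.
rewrite (_ : neg = [set w | 0 < - H w]).
  by apply: measurable_gt0; exact: measurableT_comp.
by apply/seteqP; split => w /=; rewrite oppr_gt0.
Qed.

Let mnonzero : measurable nonzero.
Proof. by rewrite nonzeroE; exact: measurableU. Qed.

Let mI (E : set T) (B : set T') : measurable E -> measurable B ->
  measurable (E `&` S @^-1` B).
Proof. by move=> mE mB; apply: measurableI => //; exact: measurable_preim. Qed.

Let intT (E : set T) (k : T -> R) : P.-integrable [set: T] (EFin \o k) ->
  measurable E -> P.-integrable E (EFin \o k).
Proof. by move=> intk mE; exact: integrableS intk. Qed.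

Let msgH : measurable_fun [set: T] (fun w => Num.sg (H w)).
Proof.
rewrite (_ : (fun _ => _) = (\1_pos : T -> R) \- \1_neg).
  by apply: measurable_funB; exact: measurable_indic.
have memE (p : T -> bool) w : (w \in [set w' | p w']) = p w.
  by apply/idP/idP => [/set_mem|/mem_set].
apply/funext => w; rewrite /= !indicE !memE.
by case: sgrP; rewrite ?subr0 ?sub0r// subrr.
Qed.

(** Here the unobserved outcome disappears: [sign_int] trades [YN] on the positive event for [Y] on
    the negative one. *)
Lemma Rintegral_effect (B : set T') : measurable B ->
  \int[P]_(w in pos `&` S @^-1` B) (Y w - YN w) =
  \int[P]_(w in pos `&` S @^-1` B) Y w - \int[P]_(w in neg `&` S @^-1` B) Y w.
Proof.
move=> mB; rewrite RintegralB ?sign_int//; first exact: mI.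
- by apply: intT => //; exact: mI.
- by apply: intT => //; exact: mI.
Qed.

Lemma Rintegral_signed (B : set T') : measurable B ->
  \int[P]_(w in nonzero `&` S @^-1` B) (2 * Num.sg (H w) * Y w) =
  2 * (\int[P]_(w in pos `&` S @^-1` B) Y w -
       \int[P]_(w in neg `&` S @^-1` B) Y w).
Proof.
move=> mB; have mpB := mI mpos mB; have mnB := mI mneg mB.
rewrite nonzeroE setIUl Rintegral_setU//.
- rewrite mulrBr -!RintegralZl//; [|exact: intT..].
  rewrite -mulN1r -RintegralZl//.
    congr (_ + _); apply: eq_Rintegral => w; rewrite inE => -[Hw _].
      by rewrite gtr0_sg// mulr1.
    by rewrite ltr0_sg// mulrN1 mulNr mulN1r.
  rewrite (_ : _ \o _ = fun w => (2%:E * (EFin \o Y) w)%E)//.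
  by apply: integrableZl => //; exact: intT.
- have mpnB : measurable (pos `&` S @^-1` B `|` neg `&` S @^-1` B).
    exact: measurableU.
  (* A sign has absolute value at most 1, so [2 * Y] dominates the integrand. *)
  have := integrableZl mpnB 2 (intT intY mpnB).
  apply: le_integrable => //.
    apply/measurable_EFinP/measurable_funTS/measurable_funM.
      by apply: measurable_funM => //; exact: msgH.
    by apply/measurable_EFinP; case/integrableP : intY.
  move=> w _ /=; rewrite lee_fin !normrM ler_wpM2r//.
  by rewrite ler_piMr// normr_sg; case: (_ != 0).
Qed.

(** The functions [tau], [m] and [m1 - mN1], composed with [S], all have the integral of [Y] over
    [pos] minus that over [neg] as their integral over [pos], on every event of [S]. Uniqueness
    under the restricted law on [pos] then identifies them. *)
Lemma regression_signed (tau m m1 mN1 : T' -> R) :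
  regression_version P pos (fun w => Y w - YN w) S tau ->
  regression_version P nonzero (fun w => 2 * Num.sg (H w) * Y w) S m ->
  regression_version P pos Y S m1 ->
  regression_version P neg Y S mN1 ->
  {ae cond_law P nonzero S, forall s, tau s = m s /\ m s = m1 s - mN1 s}.
Proof.
move=> [mtau inttau tauE] [mm intm mE] [mm1 intm1 m1E] [mmN1 intmN1 mN1E].
have sign_law' B : measurable B -> P (neg `&` S @^-1` B) = P (pos `&` S @^-1` B).
  by move=> mB; rewrite sign_law.
have intm' : P.-integrable pos (EFin \o (m \o S)).
  by apply: (integrableS mnonzero) intm => //; rewrite nonzeroE; exact: subsetUl.
(* [mN1] is a regression on [neg]; equality of the two laws of [S] makes it integrable on [pos] as
   well. *)
have intmN1' : P.-integrable pos (EFin \o (mN1 \o S)).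
  apply: (integrable_eq_law mS mneg mpos sign_law' (f := EFin \o mN1)) => //.
  exact/measurable_EFinP.
have intmB : P.-integrable pos (EFin \o ((fun s => m1 s - mN1 s) \o S)).
  rewrite (_ : _ \o _ = (EFin \o (m1 \o S)) \- (EFin \o (mN1 \o S)))%E//.
  exact: integrableB.
have tau_int B : measurable B -> \int[P]_(w in pos `&` S @^-1` B) tau (S w) =
    \int[P]_(w in pos `&` S @^-1` B) Y w - \int[P]_(w in neg `&` S @^-1` B) Y w.
  by move=> mB; rewrite -Rintegral_effect// /Rintegral tauE.
have m_int B : measurable B -> \int[P]_(w in pos `&` S @^-1` B) m (S w) =
    \int[P]_(w in pos `&` S @^-1` B) Y w - \int[P]_(w in neg `&` S @^-1` B) Y w.
  (* The integral of [m] over [nonzero] is twice that over [pos], since [S] has equal laws on [pos]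
     and [neg]. This factor matches the 2 in [Rintegral_signed]. *)
  move=> mB; apply: (@mulfI _ 2) => //.
  rewrite -Rintegral_signed// [RHS]/Rintegral mE// -[RHS]/(Rintegral _ _ _).
  have mpB := mI mpos mB; have mnB := mI mneg mB.
  rewrite nonzeroE setIUl Rintegral_setU//.
    rewrite -(Rintegral_eq_law mS mpos mneg sign_law mB mm intm').
    by rewrite mulr_natl mulr2n.
  rewrite -setIUl -nonzeroE; apply: (integrableS mnonzero) intm => //.
  exact: mI.
have mB_int B : measurable B ->
    \int[P]_(w in pos `&` S @^-1` B) (m1 (S w) - mN1 (S w)) =
    \int[P]_(w in pos `&` S @^-1` B) Y w - \int[P]_(w in neg `&` S @^-1` B) Y w.
  move=> mB; have mpB := mI mpos mB.
  rewrite RintegralB//; [|exact: integrableS intm1|exact: integrableS intmN1'].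
  rewrite (Rintegral_eq_law mS mpos mneg sign_law mB mmN1 intmN1').
  by rewrite /Rintegral m1E// mN1E.
have : {ae restricted_law P mS mpos,
    forall s, tau s = m s /\ m s = m1 s - mN1 s}.
  have taum := ae_eq_restricted_law mS mpos mtau mm inttau intm'
    (fun B mB => etrans (tau_int B mB) (esym (m_int B mB))).
  have mB := ae_eq_restricted_law mS mpos mm
    (measurable_funB mm1 mmN1) intm' intmB
    (fun B mB => etrans (m_int B mB) (esym (mB_int B mB))).
  by apply: filterS2 taum mB.
(* The same exceptional set serves for the conditional law: by [sign_law] it has no mass on [neg]
   either. *)
move=> [N [mN N0 sN]]; exists N; split => //.
move: N0; rewrite restricted_lawE => N0.
have mpN := mI mpos mN; have mnN := mI mneg mN.
have -> : cond_law P nonzero S N = ((fine (P nonzero))^-1%:E *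
    (P (pos `&` S @^-1` N) + P (neg `&` S @^-1` N)))%E.
  rewrite /cond_law [in LHS]/= {2}nonzeroE setIUl -measureU//.
  exact/disj_set2P/pos_neg_disj.
by rewrite -sign_law// N0 adde0 mule0.
Qed.

Lemma elem_cond_exp_signed (B : set T') : measurable B ->
  (0 < P (nonzero `&` S @^-1` B))%E ->
  elem_cond_exp P (pos `&` S @^-1` B) (fun w => Y w - YN w) =
    elem_cond_exp P (nonzero `&` S @^-1` B) (fun w => 2 * Num.sg (H w) * Y w) /\
  elem_cond_exp P (nonzero `&` S @^-1` B) (fun w => 2 * Num.sg (H w) * Y w) =
    elem_cond_exp P (pos `&` S @^-1` B) Y - elem_cond_exp P (neg `&` S @^-1` B) Y.
Proof.
move=> mB P0; have mpB := mI mpos mB; have mnB := mI mneg mB.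
(* The conditioning event has twice the mass of its positive half, and this 2 cancels the one in the
   signed outcome. *)
have PE : P (nonzero `&` S @^-1` B) =
    (P (pos `&` S @^-1` B) + P (pos `&` S @^-1` B))%E.
  rewrite nonzeroE setIUl measureU//.
    by congr (_ + _)%E; exact/esym/sign_law.
  exact/disj_set2P/pos_neg_disj.
rewrite /elem_cond_exp Rintegral_effect// Rintegral_signed// PE -sign_law//.
have Pfin : P (pos `&` S @^-1` B) \is a fin_num by exact: fin_num_measure.
move: P0; rewrite PE fineD// -{1 2}(fineK Pfin) -EFinD lte_fin -mulr2n.
rewrite pmulrn_lgt0// => /gt_eqF/negbT p0.
rewrite -[fine _ *+ 2]mulr_natl invfM mulrACA divff// mul1r; split => //.
by rewrite mulrBl.
Qed.

End symmetric_sign.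

(** * Application to the assignment model *)

(** A point is a finite intersection of coordinate constraints. This makes the values of [g]
    admissible as elementary conditioning points. *)
Lemma measurable_set1_tuple (R : realType) (n : nat) (t : n.-tuple R) :
  measurable [set t].
Proof.
rewrite (_ : [set t] =
    \bigcap_(i in [set: 'I_n]) (@tnth n R ^~ i) @^-1` [set tnth t i]).
  apply: fin_bigcap_measurable => // i _.
  by apply: measurable_preim => //; exact: measurable_tnth.
apply/seteqP; split => [s -> //|s st].
by apply: eq_from_tnth => i; exact: st.
Qed.

(** Integrating the constant 1/2 over an event of [Z] gives half of its mass to [W = true];
    additivity leaves the other half to [W = false]. *)
Lemma fair_coin_law (d d' : measure_display) (T : measurableType d)
    (T' : measurableType d') (R : realType) (P : probability T R)
    (Z : T -> T') (W : T -> bool) :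
  measurable_fun [set: T] Z -> measurable_fun [set: T] W ->
  regression_version P [set: T] (\1_[set w | W w = true]) Z (cst 2^-1) ->
  forall B : set T', measurable B ->
    P (W @^-1` [set true] `&` Z @^-1` B) = P (W @^-1` [set false] `&` Z @^-1` B).
Proof.
move=> mZ mW [_ _ half] B mB.
have mC := measurable_preim mZ mB; have mWb b := measurable_coin mW b.
have PW : P (W @^-1` [set true] `&` Z @^-1` B) = (2^-1%:E * P (Z @^-1` B))%E.
  have := half B mB; rewrite setTI integral_indic//=; last exact: mWb true.
  by rewrite (integral_cst _ mC (2^-1)%:E).
have PC : P (Z @^-1` B) = (P (W @^-1` [set true] `&` Z @^-1` B) +
    P (W @^-1` [set false] `&` Z @^-1` B))%E.
  rewrite -measureU//; [|exact: measurableI..|exact/disj_set2P/disj_coin].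
  congr (P _); apply/seteqP; split => [w Bw|w [] []//].
  by case E : (W w); [left|right].
have ft : P (W @^-1` [set true] `&` Z @^-1` B) \is a fin_num.
  by apply: fin_num_measure; exact: measurableI.
have ff : P (W @^-1` [set false] `&` Z @^-1` B) \is a fin_num.
  by apply: fin_num_measure; exact: measurableI.
move: PW; rewrite PC -(fineK ft) -(fineK ff) -EFinD -EFinM => -[PW].
congr EFin; move: PW; lra.
Qed.

Theorem theorem2 (R : realType) (dO dA dX : measure_display)
    (Omega : measurableType dO) (P : probability Omega R)
    (TA : measurableType dA) (TX : measurableType dX) (d q : nat)
    (Y : TA -> {RV P >-> R}) (A : bool -> {RV P >-> TA})
    (X : {RV P >-> TX}) (W : {RV P >-> bool})
    (f : TA -> d.-tuple R)
    (h : d.-tuple R * d.-tuple R -> R)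
    (g : d.-tuple R * d.-tuple R -> q.-tuple R) :
  let Yof : (Omega -> TA) -> Omega -> R := outcome (fun a => Y a : Omega -> R) in
  let Aof : bool -> Omega -> TA := fun b => A b in
  let A_ : Omega -> TA := realized W Aof in
  let AN : Omega -> TA := nonrealized W Aof in
  let Y_ : Omega -> R := Yof A_ in
  let YN : Omega -> R := Yof AN in
  let V : Omega -> d.-tuple R := f \o A_ in
  let VN : Omega -> d.-tuple R := f \o AN in
  let tau_ : Omega -> R := fun w => Y_ w - YN w in
  let H : Omega -> R := fun w => h (V w, VN w) in
  let G : Omega -> q.-tuple R := fun w => g (V w, VN w) in
  let D : Omega -> R := fun w => Num.sg (H w) in
  let XG : Omega -> TX * q.-tuple R := fun w => (X w, G w) in
  measurable_fun [set: TA] f ->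
  measurable_fun [set: d.-tuple R * d.-tuple R] h ->
  measurable_fun [set: d.-tuple R * d.-tuple R] g ->
  (forall b : bool, P.-integrable [set: Omega] (EFin \o Yof (A b))) ->
  (forall v v' : d.-tuple R, h (v, v') = - h (v', v)) ->
  (forall v v' : d.-tuple R, g (v, v') = g (v', v)) ->
  regression_version P [set: Omega] (\1_[set w | W w = true])
    (fun w => (A false w, A true w, Yof (A false) w, Yof (A true) w, X w))
    (cst (2^-1)) ->
  (0 < P [set w | D w != 0%R])%E ->
  (forall tau m m1 mN1 : TX * q.-tuple R -> R,
     regression_version P [set w | 0 < H w] tau_ XG tau ->
     regression_version P [set w | D w != 0] (fun w => 2 * D w * Y_ w) XG m ->
     regression_version P [set w | D w = 1] Y_ XG m1 ->
     regression_version P [set w | D w = -1] Y_ XG mN1 ->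
     {ae cond_law P [set w | D w != 0] XG,
       forall s, tau s = m s /\ m s = m1 s - mN1 s}) /\
  (forall (x : TX) (gamma : q.-tuple R),
     measurable [set x] ->
     (0 < P [set w | [/\ X w = x, G w = gamma & D w != 0%R]])%E ->
     elem_cond_exp P [set w | [/\ X w = x, 0 < H w & G w = gamma]] tau_ =
       elem_cond_exp P [set w | [/\ X w = x, G w = gamma & D w != 0]]
         (fun w => 2 * D w * Y_ w) /\
     elem_cond_exp P [set w | [/\ X w = x, G w = gamma & D w != 0]]
         (fun w => 2 * D w * Y_ w) =
       elem_cond_exp P [set w | [/\ X w = x, D w = 1 & G w = gamma]] Y_ -
       elem_cond_exp P [set w | [/\ X w = x, D w = -1 & G w = gamma]] Y_).
Proof.
move=> Yof Aof A_ AN Y_ YN V VN tau_ H G D XG mf mh mg intY hanti gsym coin D0.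
(* [Z] is the conditioning vector of the coin assumption. The functions below rewrite the model in
   terms of [Z] and the coin value [b]; [xg] takes no [b] because [g] is symmetric. *)
pose Z w := (A false w, A true w, Yof (A false) w, Yof (A true) w, X w).
pose a (b : bool) (z : TA * TA * R * R * TX) :=
  if b then z.1.1.1.2 else z.1.1.1.1.
pose y (b : bool) (z : TA * TA * R * R * TX) := if b then z.1.2 else z.1.1.2.
pose hs (b : bool) z := h (f (a b z), f (a (~~ b) z)).
pose xg z := (z.2, g (f (a true z), f (a false z))).
(* Each [Y a] is measurable for fixed [a] only, so measurability at a random treatment is drawn from
   integrability. *)
have mY b : measurable_fun [set: Omega] (Yof (A b)).
  by apply/measurable_EFinP; case/integrableP : (intY b).
have mZ : measurable_fun [set: Omega] Z.
  by do 4 apply: measurable_fun_pair => //.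
have ma b : measurable_fun setT (a b).
  by rewrite /a; case: b; do 4 apply: measurableT_comp => //.
have my b : measurable_fun setT (y b).
  by rewrite /y; case: b; do 3 apply: measurableT_comp => //.
have mhs b : measurable_fun setT (hs b).
  apply: measurableT_comp => //.
  by apply: measurable_fun_pair; exact: measurableT_comp.
have mxg : measurable_fun setT xg.
  apply: measurable_fun_pair => //; apply: measurableT_comp => //.
  by apply: measurable_fun_pair; exact: measurableT_comp.
have hsN b z : hs (~~ b) z = - hs b z by rewrite /hs negbK hanti.
have YE : Y_ = fun w => y (W w) (Z w).
  by apply/funext => w; rewrite /Y_ /Yof /outcome /A_ /realized /y; case: (W w).
have YNE : YN = fun w => y (~~ W w) (Z w).
  apply/funext => w; rewrite /YN /Yof /outcome /AN /nonrealized /y.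
  by case: (W w).
have HE : H = fun w => hs (W w) (Z w).
  apply/funext => w; rewrite /H /V /VN /= /A_ /AN /realized /nonrealized /hs /a.
  by case: (W w).
have XGE : XG = xg \o Z.
  apply/funext => w; rewrite /XG /G /V /VN /= /A_ /AN /realized /nonrealized.
  by rewrite /xg /a/=; case: (W w) => //=; rewrite gsym.
have mW : measurable_fun [set: Omega] W by [].
have fair := fair_coin_law mZ mW coin.
have inty b : P.-integrable [set: Omega] (EFin \o (y b \o Z)).
  by case: b; [exact: intY true|exact: intY false].
have intY_ : P.-integrable [set: Omega] (EFin \o Y_).
  by rewrite YE; exact: integrable_coin.
have intYN : P.-integrable [set: Omega] (EFin \o YN).
  by rewrite YNE; exact: (integrable_coin (u := fun b => y (~~ b)) mZ mW).
have mH : measurable_fun [set: Omega] H.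
  by rewrite HE; exact: (measurable_coin_fun mZ mW mhs).
have mXG : measurable_fun [set: Omega] XG.
  by rewrite XGE; exact: measurableT_comp.
(* Evaluated at [W w] this family is the positive event; at [~~ W w] it is the negative one, since
   [hs] changes sign under the flip. *)
pose S B b := [set z | 0 < hs b z] `&` xg @^-1` B.
have mS B b : measurable B -> measurable (S B b).
  move=> mB; apply: measurableI; first exact: measurable_gt0.
  exact: measurable_preim.
have posE B : [set w | 0 < H w] `&` XG @^-1` B = [set w | S B (W w) (Z w)].
  by rewrite HE XGE.
have negE B : [set w | H w < 0] `&` XG @^-1` B = [set w | S B (~~ W w) (Z w)].
  by rewrite HE XGE; apply/seteqP; split => w; rewrite /S /= hsN oppr_gt0.
have sign_law B : measurable B -> P ([set w | 0 < H w] `&` XG @^-1` B) =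
    P ([set w | H w < 0] `&` XG @^-1` B).
  move=> mB; rewrite posE negE; apply: (measure_coin_flip mZ mW fair) => b.
  exact: mS.
have sign_int B : measurable B ->
    \int[P]_(w in [set w | 0 < H w] `&` XG @^-1` B) YN w =
    \int[P]_(w in [set w | H w < 0] `&` XG @^-1` B) Y_ w.
  move=> mB; rewrite posE negE YE YNE.
  (* [YN] is [y] at the negated coin, so the flip produces a double negation, which is [Y_]. *)
  rewrite (Rintegral_coin_flip (u := fun b => y (~~ b)) mZ mW fair)//; last first.
    by move=> b; exact: mS.
  by apply: eq_Rintegral => w _; rewrite negbK.
have D1 : [set w | D w = 1] = [set w | 0 < H w].
  by apply/seteqP; split => w /=; rewrite -sgr_cp0 => /eqP.
have DN1 : [set w | D w = -1] = [set w | H w < 0].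
  by apply/seteqP; split => w /=; rewrite -sgr_cp0 => /eqP.
split.
  move=> tau m m1 mN1; rewrite D1 DN1.
  exact: (regression_signed mH mXG intY_ intYN sign_law sign_int).
move=> x gamma mx P0.
(* Elementary conditioning is the case of a one-point event of [XG]. *)
have mB : measurable [set (x, gamma)].
  rewrite (_ : [set _] = [set x] `*` [set gamma]).
    by apply: measurableX => //; exact: measurable_set1_tuple.
  by apply/seteqP; split => [_ ->//|[? ?] /= [-> ->]].
have XG1 w : XG w = (x, gamma) <-> X w = x /\ G w = gamma.
  exact: pair_equal_spec.
have setE (E : Omega -> Prop) : [set w | [/\ X w = x, G w = gamma & E w]] =
    [set w | E w] `&` XG @^-1` [set (x, gamma)].
  apply/seteqP; split => w /=; first by case=> Xw Gw Ew; split => //; apply/XG1.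
  by case=> Ew /XG1[].
have setE' (E : Omega -> Prop) : [set w | [/\ X w = x, E w & G w = gamma]] =
    [set w | E w] `&` XG @^-1` [set (x, gamma)].
  by rewrite -setE; apply/seteqP; split => w /= [].
rewrite !setE !setE' D1 DN1.
apply: (elem_cond_exp_signed mH mXG intY_ intYN sign_law sign_int mB).
by rewrite -setE.
Qed.
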